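(* Let $n,r\ge 1$, let $A=(A_{ji})$ be a real $r\times n$ matrix with linearly independent rows, let $\mathbf{w}\in\mathbb{R}^n$ with all $w_i>0$ and $\mathbf{t}\in\mathbb{R}^r$ with all $t_j>0$. Consider the system of $n+r$ equations $$w_i x_i=\sum_{j=1}^r \lambda_j A_{ji}\quad (i=1,\dots,n),\qquad \sum_{i=1}^n A_{ji}\log x_i=\log t_j\quad (j=1,\dots,r).$$ A solution $(\mathbf{x},\lambda_1,\dots,\lambda_r)$ of this system with $\mathbf{x}\in\mathbb{R}^n_{\ge 0}$ and $\lambda_1,\dots,\lambda_r\in\mathbb{R}$, if it exists, is unique. Therefore, in the problem of minimizing $\langle \mathbf{x},\mathbf{w}\rangle=\sum_i w_i x_i$ over all $\mathbf{x}\ge 0$ satisfying $\sum_{i} A_{ji}\log x_i=\log t_j$ ($j=1,\dots,r$), if the system of constraints is compact then there exists a unique minimizer.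
   Context: A variable $x_i$ is called nonessential if $A_{ji}=0$ for all $j$, and essential otherwise. In the constraint equations essential variables must be strictly positive, while nonessential variables may take any value $\ge 0$ (terms $A_{ji}\log x_i$ with $A_{ji}=0$ are read as $0$). The system of constraints is called compact if some linear combination of the rows of $A$ has strictly positive coefficients at all essential variables. A minimizer is a vector satisfying the constraints at which the infimum of $\langle \mathbf{x},\mathbf{w}\rangle$ subject to the constraints is attained. *)

(* Defs.v *)
From HB Require Import structures.
From mathcomp Require Import all_boot all_order all_algebra.
From mathcomp Require Import all_classical all_reals all_analysis.

Set Implicit Arguments.
Unset Strict Implicit.
Unset Printing Implicit Defensive.

Import Order.TTheory GRing.Theory Num.Theory.

Local Open Scope classical_set_scope.
Local Open Scope ring_scope.

(* Vectors of R^n and R^r are row vectors; [A j i] is the entry A_{ji}. *)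

Definition nonessential (R : realType) (n r : nat) (A : 'M[R]_(r, n))
    (i : 'I_n) : bool :=
  [forall j : 'I_r, A j i == 0].

Definition essential (R : realType) (n r : nat) (A : 'M[R]_(r, n))
    (i : 'I_n) : bool :=
  ~~ nonessential A i.

(* The positivity of the essential variables is part of the constraints: [ln]
   is total, with [ln x = 0] for [x <= 0].  The terms with [A j i = 0] vanish
   whatever the value of [ln (x 0 i)]. *)
Definition constraints (R : realType) (n r : nat) (A : 'M[R]_(r, n))
    (t : 'rV[R]_r) : set 'rV[R]_n :=
  [set x | [/\ forall i : 'I_n, 0 <= x 0 i,
               forall i : 'I_n, essential A i -> 0 < x 0 i
             & forall j : 'I_r, \sum_(i < n) A j i * ln (x 0 i) = ln (t 0 j)]].

Definition is_solution (R : realType) (n r : nat) (A : 'M[R]_(r, n))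
    (w : 'rV[R]_n) (t : 'rV[R]_r) (x : 'rV[R]_n) (lambda : 'rV[R]_r) : Prop :=
  constraints A t x /\
  forall i : 'I_n, w 0 i * x 0 i = \sum_(j < r) lambda 0 j * A j i.

Definition compact_constraints (R : realType) (n r : nat) (A : 'M[R]_(r, n)) :
    Prop :=
  exists c : 'rV[R]_r,
    forall i : 'I_n, essential A i -> 0 < \sum_(j < r) c 0 j * A j i.

Definition inner (R : realType) (n : nat) (x w : 'rV[R]_n) : R :=
  \sum_(i < n) w 0 i * x 0 i.

Definition is_minimizer (R : realType) (n r : nat) (A : 'M[R]_(r, n))
    (w : 'rV[R]_n) (t : 'rV[R]_r) (x : 'rV[R]_n) : Prop :=
  constraints A t x /\
  (inner x w)%:E = ereal_inf [set (inner y w)%:E | y in constraints A t].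

(* Main.v *)
Require Import Defs.
From HB Require Import structures.
From mathcomp Require Import all_boot all_order all_algebra.
From mathcomp Require Import all_classical all_reals all_analysis.
From mathcomp Require Import ring lra.

Set Implicit Arguments.
Unset Strict Implicit.
Unset Printing Implicit Defensive.

Import Order.TTheory GRing.Theory Num.Theory.
Import numFieldNormedType.Exports.

Local Open Scope classical_set_scope.
Local Open Scope ring_scope.

(** If (x, lambda) and (x', lambda') solve the system, then the sum of
    w_i (x_i - x'_i) (ln x_i - ln x'_i) is a combination of the rows of A paired
    with ln x - ln x', hence zero; each term is nonnegative, so x = x', and
    independence of the rows gives lambda = lambda'.

    The constraints are affine in the logarithms, so the coordinatewise geometric
    mean of two feasible points is feasible; by AM-GM it is strictly cheaper than
    their average unless they coincide. This makes the minimizer unique.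

    On a sublevel set of the cost the logarithms are bounded above. The positive
    combination of the rows of A fixes a positive combination of the logarithms
    of the essential variables, so these are also bounded below, and the minimum
    is attained by compactness in logarithmic coordinates. *)

Lemma ltr_subr_mul_ln (R : realType) (a b : R) :
  0 < a -> 0 < b -> a != b -> 0 < (a - b) * (ln a - ln b).
Proof.
move=> a0 b0; case: (ltgtP a b) => // ab _.
  by rewrite nmulr_rgt0 ?subr_lt0 // ltr_ln ?posrE.
by rewrite pmulr_rgt0 ?subr_gt0 // ltr_ln ?posrE.
Qed.

Lemma ln_le_id (R : realType) (a : R) : 0 <= a -> ln a <= a.
Proof.
rewrite le_eqVlt => /predU1P[<-|/ln_sublinear/ltW //].
by rewrite ln0.
Qed.

Lemma ln_sqrtM (R : realType) (a b : R) : 0 < a -> 0 < b ->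
  ln (Num.sqrt (a * b)) = (ln a + ln b) / 2.
Proof.
move=> a0 b0; have ab0 : 0 < Num.sqrt (a * b) by rewrite sqrtr_gt0 mulr_gt0.
have := lnXn 2 ab0; rewrite sqr_sqrtr ?lnM ?posrE // ?mulr_ge0 ?ltW // => ->.
by rewrite mulr2n; field.
Qed.

Lemma continuous_lincomb (R : realType) (T : topologicalType) (m : nat)
    (a : 'I_m -> R) (F : 'I_m -> T -> R) :
  (forall i, continuous (F i)) -> continuous (fun y => \sum_(i < m) a i * F i y).
Proof.
move=> cF; apply: continuous_big => [|i _ y]; first exact: add_continuous.
by apply: cvgMl_tmp; exact: cF.
Qed.

(** * Uniqueness of the solution of the system *)

Section Constraints.
Variables (R : realType) (n r : nat) (A : 'M[R]_(r, n)).

Lemma nonessential_coef (i : 'I_n) (j : 'I_r) : ~~ essential A i -> A j i = 0.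
Proof. by rewrite negbK => /forallP/(_ j)/eqP. Qed.

(** The right side does not involve [x]: a combination of the rows takes the same value on the
    logarithms of all feasible points. *)
Lemma constraints_comb (t : 'rV[R]_r) (c : 'I_r -> R) (x : 'rV[R]_n) :
  constraints A t x ->
  \sum_(i < n) (\sum_(j < r) c j * A j i) * ln (x 0 i)
    = \sum_(j < r) c j * ln (t 0 j).
Proof.
case=> _ _ xt; under eq_bigr do rewrite mulr_suml.
rewrite exchange_big /=; apply: eq_bigr => j _.
by rewrite -xt mulr_sumr; apply: eq_bigr => i _; rewrite mulrA.
Qed.

Variables (w : 'rV[R]_n) (t : 'rV[R]_r).
Hypothesis w_gt0 : forall i, 0 < w 0 i.

Lemma solution_unique (x x' : 'rV[R]_n) (l l' : 'rV[R]_r) : row_free A ->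
  is_solution A w t x l -> is_solution A w t x' l' -> x = x' /\ l = l'.
Proof.
move=> Afree [xC xl] [x'C x'l].
(* The constraints leave nonessential coordinates free; the multiplier equation, whose right side
   vanishes there, forces them to be 0. *)
have wE (y : 'rV[R]_n) (m : 'rV[R]_r) i :
    w 0 i * y 0 i = \sum_(j < r) m 0 j * A j i -> ~~ essential A i -> y 0 i = 0.
  move=> e ni; have /eqP := e.
  rewrite big1 => [|j _]; last by rewrite nonessential_coef // mulr0.
  by rewrite mulf_eq0 gt_eqF //= => /eqP.
pose D i := w 0 i * ((x 0 i - x' 0 i) * (ln (x 0 i) - ln (x' 0 i))).
have Dgt0 i : x 0 i != x' 0 i -> 0 < D i.
  move=> ne; have [ei|ni] := boolP (essential A i).
    by rewrite mulr_gt0 // ltr_subr_mul_ln //; [case: xC|case: x'C] => _ /(_ i ei).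
  by move: ne; rewrite (wE _ _ _ (xl i) ni) (wE _ _ _ (x'l i) ni) eqxx.
have Dge0 i : 0 <= D i.
  have [e|/Dgt0/ltW //] := eqVneq (x 0 i) (x' 0 i).
  by rewrite /D e !subrr mulr0 mulr0.
have D0 : \sum_(i < n) D i = 0.
  transitivity (\sum_(i < n) (\sum_(j < r) (l 0 j - l' 0 j) * A j i) * ln (x 0 i)
     - \sum_(i < n) (\sum_(j < r) (l 0 j - l' 0 j) * A j i) * ln (x' 0 i)).
    rewrite -sumrB; apply: eq_bigr => i _; rewrite -mulrBr /D mulrA; congr (_ * _).
    rewrite mulrBr xl x'l -sumrB; apply: eq_bigr => j _.
    by rewrite mulrBl.
  by rewrite (constraints_comb _ xC) (constraints_comb _ x'C) subrr.
have xx' : x = x'.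
  apply/rowP => i; apply/eqP/negPn/negP => /Dgt0.
  by rewrite (psumr_eq0P (fun i _ => Dge0 i) D0) ?ltxx.
split=> //; apply: (row_free_inj Afree); apply/rowP => i.
by rewrite !mxE -xl -x'l xx'.
Qed.

(** * Uniqueness of the minimizer *)

Lemma is_minimizerP (x : 'rV[R]_n) : is_minimizer A w t x <->
  constraints A t x /\
  forall y, constraints A t y -> inner x w <= inner y w.
Proof.
split=> -[xC xmin]; split=> //.
  move=> y yC; rewrite -lee_fin xmin; apply: ereal_inf_lbound.
  by exists y.
apply/eqP; rewrite eq_le; apply/andP; split.
  by apply: le_ereal_inf_tmp => _ [y yC <-]; rewrite lee_fin xmin.
by apply: ereal_inf_lbound; exists x.
Qed.

Lemma constraints_gmean (x y : 'rV[R]_n) :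
  constraints A t x -> constraints A t y ->
  constraints A t (\row_i Num.sqrt (x 0 i * y 0 i)).
Proof.
move=> [x0 xp xt] [y0 yp yt]; split=> [i|i ei|j]; rewrite ?mxE ?sqrtr_ge0 //.
  by rewrite sqrtr_gt0 mulr_gt0 ?xp ?yp.
transitivity (\sum_(i < n) (A j i * ln (x 0 i) + A j i * ln (y 0 i)) / 2).
  apply: eq_bigr => i _; rewrite mxE.
  (* A nonessential coordinate may be 0, where [ln_sqrtM] does not apply, but its coefficient is
     0. *)
  have [ei|ni] := boolP (essential A i); last by rewrite nonessential_coef //; ring.
  by rewrite ln_sqrtM ?xp ?yp //; ring.
by rewrite -mulr_suml big_split /= xt yt; field.
Qed.

Lemma minimizer_unique (x y : 'rV[R]_n) :
  is_minimizer A w t x -> is_minimizer A w t y -> x = y.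
Proof.
move=> /is_minimizerP[xC xmin] /is_minimizerP[yC ymin].
have [x0 _ _] := xC; have [y0 _ _] := yC.
have zC := constraints_gmean xC yC.
(* The weighted AM-GM defect; minimality of [x] and [y] against their geometric mean makes its sum
   nonpositive. *)
pose D i := w 0 i * (Num.sqrt (x 0 i) - Num.sqrt (y 0 i)) ^+ 2.
have Dge0 i : 0 <= D i by rewrite mulr_ge0 ?sqr_ge0 ?ltW.
have DE : \sum_(i < n) D i =
    inner x w + inner y w - 2 * inner (\row_i Num.sqrt (x 0 i * y 0 i)) w.
  rewrite mulr_sumr -big_split -sumrB; apply: eq_bigr => i _ /=.
  by rewrite mxE /D sqrrB !sqr_sqrtr // sqrtrM //; ring.
have D0 : \sum_(i < n) D i = 0.
  apply/eqP; rewrite eq_le sumr_ge0 // andbT DE.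
  by have := xmin _ zC; have := ymin _ zC; lra.
apply/rowP => i; apply/eqP; rewrite -eqr_sqrt // -subr_eq0 -sqrf_eq0.
have /eqP := psumr_eq0P (fun i _ => Dge0 i) D0 (erefl : xpredT i).
by rewrite mulf_eq0 gt_eqF.
Qed.

(** * Bounds on the logarithms over a sublevel set *)

Lemma coord_le_cost (x : 'rV[R]_n) (M : R) (i : 'I_n) :
  (forall i, 0 <= x 0 i) -> inner x w <= M -> x 0 i <= M / w 0 i.
Proof.
move=> x0 xM; rewrite ler_pdivlMr // mulrC; apply: le_trans xM.
rewrite /inner (bigD1 i) //= lerDl sumr_ge0 // => k _.
by rewrite mulr_ge0 // ltW.
Qed.

Lemma sublevel_ln_bounded (M : R) : compact_constraints A ->
  exists2 B : R, 0 <= B & forall x, constraints A t x -> inner x w <= M ->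
    forall i, essential A i -> `|ln (x 0 i)| <= B.
Proof.
move=> [c c_gt0].
pose d i := \sum_(j < r) c 0 j * A j i.
have d_ge0 i : 0 <= d i.
  have [/c_gt0/ltW //|ni] := boolP (essential A i).
  by rewrite /d big1 // => j _; rewrite nonessential_coef // mulr0.
(* [L] bounds every logarithm above, through [ln a <= a]; the absolute value makes each term
   nonnegative, so the sum dominates each of them. *)
pose L := \sum_(i < n) `|M| / w 0 i.
pose T := \sum_(j < r) c 0 j * ln (t 0 j).
(* [T] is the common value of the sum of [d i * ln (x 0 i)]. Bounding all terms but the [k]-th by
   [L] leaves at least [E] for [d k * ln (x 0 k)]. *)
pose E := T - (\sum_(i < n) d i) * L.
(* Where [d i = 0], at nonessential [i], division by zero gives 0. *)
pose S := \sum_(i < n) `|E| / d i.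
have L_term i : 0 <= `|M| / w 0 i by rewrite divr_ge0 // ltW.
have S_term i : 0 <= `|E| / d i by rewrite divr_ge0.
have L_ge0 : 0 <= L by apply: sumr_ge0.
have S_ge0 : 0 <= S by apply: sumr_ge0.
exists (L + S) ; first by rewrite addr_ge0.
move=> x xC xM.
have [x0 xp xt] := xC.
have lnL i : ln (x 0 i) <= L.
  apply: le_trans (ln_le_id (x0 i)) _.
  apply: le_trans (coord_le_cost i x0 xM) _.
  apply: (@le_trans _ _ (`|M| / w 0 i)).
    by rewrite ler_pM2r ?invr_gt0 // ler_norm.
  by rewrite /L (bigD1 i) //= lerDl sumr_ge0.
move=> k ek; have dk : 0 < d k by apply: c_gt0.
rewrite ler_norml; apply/andP; split; last by rewrite (le_trans (lnL k)) ?lerDl.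
have lnk : E <= d k * ln (x 0 k).
  have := constraints_comb (fun j => c 0 j) xC; rewrite -/T (bigD1 k) //=.
  rewrite -/(d k) => TE.
  have le1 : \sum_(i < n | i != k) d i * ln (x 0 i) <= (\sum_(i < n) d i) * L.
    rewrite [leRHS]mulr_suml.
    rewrite [leRHS](bigD1 k) //= -[leLHS]add0r lerD ?mulr_ge0 //.
    by apply: ler_sum => i _; rewrite ler_wpM2l.
  by rewrite /E -TE lerBlDr lerD2l.
have kS : `|E| / d k <= S by rewrite /S (bigD1 k) //= lerDl sumr_ge0.
apply: (@le_trans _ _ (- (`|E| / d k))).
  by rewrite lerN2 (le_trans kS) // lerDr.
rewrite -mulNr ler_pdivrMr // mulrC (le_trans _ lnk) // lerNl.
by rewrite -normrN ler_norm.
Qed.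

(** * Logarithmic coordinates and existence of a minimizer *)

Definition exp_point (y : 'rV[R]_n) : 'rV[R]_n :=
  \row_i (if essential A i then expR (y 0 i) else 0).

(** The 0 at nonessential coordinates does not affect the equations and lies in every interval
    [[-B, B]] with [B >= 0]. *)
Definition log_point (x : 'rV[R]_n) : 'rV[R]_n :=
  \row_i (if essential A i then ln (x 0 i) else 0).

Definition log_feasible : set 'rV[R]_n :=
  [set y | forall j, \sum_(i < n) A j i * y 0 i = ln (t 0 j)].

Lemma exp_point_constraints (y : 'rV[R]_n) :
  log_feasible y -> constraints A t (exp_point y).
Proof.
move=> yt; split=> [i|i ei|j]; rewrite ?mxE.
- by case: ifP => // _; rewrite expR_ge0.
- by rewrite ei expR_gt0.
rewrite -yt; apply: eq_bigr => i _; rewrite mxE.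
by case: ifPn => [_|ni]; rewrite ?expRK // nonessential_coef // !mul0r.
Qed.

Lemma log_point_feasible (x : 'rV[R]_n) :
  constraints A t x -> log_feasible (log_point x).
Proof.
case=> _ _ xt j; rewrite -xt; apply: eq_bigr => i _; rewrite mxE.
by case: ifPn => // ni; rewrite nonessential_coef // !mul0r.
Qed.

(** The round trip fixes essential coordinates and resets the others to 0, their cheapest value, so
    minimizing over the image of [exp_point] suffices. *)
Lemma exp_log_point_le (x : 'rV[R]_n) : constraints A t x ->
  inner (exp_point (log_point x)) w <= inner x w.
Proof.
case=> x0 xp _; apply: ler_sum => i _; rewrite ler_pM2l // !mxE.
by case: (boolP (essential A i)) => // ei; rewrite lnK ?posrE ?xp.
Qed.

Lemma cost_exp_continuous : continuous (fun y => inner (exp_point y) w).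
Proof.
have -> : (fun y => inner (exp_point y) w) = (fun y : 'rV[R]_n =>
    \sum_(i < n) w 0 i * (if essential A i then expR (y 0 i) else 0)).
  by apply/funext => y; apply: eq_bigr => i _; rewrite mxE.
apply: continuous_lincomb => i.
have [_|_] := boolP (essential A i); last exact: cst_continuous.
move=> y; apply: continuous_comp; first exact: coord_continuous.
exact: continuous_expR.
Qed.

Lemma closed_log_feasible : closed log_feasible.
Proof.
have -> : log_feasible = \bigcap_(j in [set: 'I_r])
    ((fun y : 'rV[R]_n => \sum_(i < n) A j i * y 0 i) @^-1` [set u | u = ln (t 0 j)]).
  by apply/seteqP; split=> [y yt j _|y yt j]; [exact: yt|exact: (yt j I)].
apply: closed_bigI => j _.
apply: preimage_closed; last exact: closed_eq.
by move=> y _; apply: continuous_lincomb => i; exact: coord_continuous.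
Qed.

Lemma minimizer_exists : row_free A -> compact_constraints A ->
  exists x, is_minimizer A w t x.
Proof.
move=> Afree Acomp.
have [y0 y0t] : log_feasible !=set0.
  (* Independent rows make [pinvmx A] a right inverse of [A]. *)
  exists (pinvmx A *m \col_j ln (t 0 j))^T => j.
  have := congr1 (fun N : 'cV[R]_r => N j 0)
    (mulmxA A (pinvmx A) (\col_j ln (t 0 j))).
  rewrite mulmxVp // mul1mx !mxE => <-.
  by apply: eq_bigr => i _; rewrite [_^T _ _]mxE.
pose x0 := exp_point y0; have x0C := exp_point_constraints y0t.
have [B B_ge0 HB] := sublevel_ln_bounded (inner x0 w) Acomp.
pose K := [set y : 'rV[R]_n | forall i, `[- B, B]%classic (y ord0 i)] `&` log_feasible.
have logK x : constraints A t x -> inner x w <= inner x0 w -> K (log_point x).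
  move=> xC xM; split; last exact: log_point_feasible.
  move=> i /=; rewrite in_itv /= -ler_norml mxE.
  case: ifPn => [ei|_]; first exact: HB xM i ei.
  by rewrite normr0.
have Kcompact : compact K.
  apply: compact_closedI closed_log_feasible.
  apply: (rV_compact (A := fun=> `[- B, B]%classic)) => i; exact: segment_compact.
have K0 : K !=set0 by exists (log_point x0); exact: logK.
have [y yK ymin] := EVT_min_rV K0 Kcompact
  (continuous_subspaceT cost_exp_continuous).
have yt : log_feasible y by move: yK; rewrite inE => -[].
exists (exp_point y); apply/is_minimizerP; split; first exact: exp_point_constraints.
have sublevel x : constraints A t x -> inner x w <= inner x0 w ->
    inner (exp_point y) w <= inner x w.
  move=> xC xM; apply: le_trans (exp_log_point_le xC).
  by apply: ymin; rewrite inE; exact: logK.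
(* A point costlier than [x0] is handled by comparison with [x0], which lies in its own sublevel
   set. *)
move=> x xC; have [/sublevel|/ltW] := leP (inner x w) (inner x0 w); first exact.
by apply: le_trans; exact: sublevel.
Qed.

End Constraints.

Theorem mainTheorem2 (R : realType) (n r : nat) (A : 'M[R]_(r, n))
    (w : 'rV[R]_n) (t : 'rV[R]_r)
    (hn : (1 <= n)%N) (hr : (1 <= r)%N)
    (hA : row_free A)
    (hw : forall i : 'I_n, 0 < w 0 i)
    (ht : forall j : 'I_r, 0 < t 0 j) :
  (forall (x x' : 'rV[R]_n) (lambda lambda' : 'rV[R]_r),
     is_solution A w t x lambda -> is_solution A w t x' lambda' ->
     x = x' /\ lambda = lambda') /\
  (compact_constraints A -> exists! x : 'rV[R]_n, is_minimizer A w t x).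
Proof.
split=> [x x' l l'|Acomp]; first exact: solution_unique.
have [x xmin] := minimizer_exists t hw hA Acomp.
by exists x; split=> // y; exact: minimizer_unique.
Qed.
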